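(* For every integer $k\geq 1$ there exists a constant $c_k>0$ such that for every $n\geq 2$, if $G$ is an $n$-vertex graph that contains neither $H_k$ nor its complement $H_k^{\mathrm{c}}$ as an induced subgraph, then $\hom(G)>n^{c_k}$.
   Context: All graphs are finite and simple. For a graph $G$, a set of vertices is homogeneous if it induces a clique or an independent set, and $\hom(G)$ denotes the maximum size of a homogeneous set in $G$. $G^{\mathrm{c}}$ denotes the complement of $G$. For $k\geq 0$, the $k$-hook $H_k$ is the graph on vertices $v_1,\ldots,v_{k+4}$ whose edges are $v_iv_{i+1}$ for $1\leq i\leq k+2$ (so $v_1,\ldots,v_{k+3}$ form an induced path) together with the pendant edge $v_{k+1}v_{k+4}$. *)

(* Defs.v *)
From mathcomp Require Import all_boot.

Set Implicit Arguments.
Unset Strict Implicit.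
Unset Printing Implicit Defensive.

Record sgraph := SGraph {
  vertex :> finType;
  adj : rel vertex;
  adj_sym : symmetric adj;
  adj_irrefl : irreflexive adj
}.

Section Complement.
Variable G : sgraph.

Definition compl_adj : rel G := fun x y => (x != y) && ~~ adj x y.

Lemma compl_adj_sym : symmetric compl_adj.
Proof. by move=> x y; rewrite /compl_adj eq_sym adj_sym. Qed.

Lemma compl_adj_irrefl : irreflexive compl_adj.
Proof. by move=> x; rewrite /compl_adj eqxx. Qed.

Definition compl : sgraph := SGraph compl_adj_sym compl_adj_irrefl.

End Complement.

Definition clique (G : sgraph) (A : {set G}) : bool :=
  [forall x in A, forall y in A, (x != y) ==> adj x y].

Definition independent (G : sgraph) (A : {set G}) : bool :=
  [forall x in A, forall y in A, ~~ adj x y].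

Definition homogeneous (G : sgraph) (A : {set G}) : bool :=
  clique A || independent A.

Definition hom_num (G : sgraph) : nat :=
  \max_(A : {set G} | homogeneous A) #|A|.

Definition contains_induced (G H : sgraph) : Prop :=
  exists f : H -> G, injective f /\ forall x y, adj (f x) (f y) = adj x y.

Section Hook.
Variable k : nat.

(* Vertices are numbered from 0: the ordinal i stands for v_(i+1). Thus
   v_1, ..., v_(k+3) are the ordinals 0, ..., k+2, and the pendant edge
   v_(k+1)v_(k+4) joins the ordinals k and k+3. *)
Definition hook_arc (i j : 'I_(k + 4)) : bool :=
  ((i.+1 == j :> nat) && (j <= k + 2))
  || ((i == k :> nat) && (j == k + 3 :> nat)).

Definition hook_adj : rel 'I_(k + 4) :=
  fun i j => hook_arc i j || hook_arc j i.

Lemma hook_adj_sym : symmetric hook_adj.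
Proof. by move=> i j; rewrite /hook_adj orbC. Qed.

Lemma hook_adj_irrefl : irreflexive hook_adj.
Proof.
move=> i; rewrite /hook_adj orbb /hook_arc -[i.+1]addn1 -{2}[nat_of_ord i]addn0.
rewrite eqn_add2l /=; case: eqP => //= ->.
by rewrite -{1}[k]addn0 eqn_add2l.
Qed.

Definition hook : sgraph := SGraph hook_adj_sym hook_adj_irrefl.

End Hook.

(* Main.v *)
Require Import Defs.
From mathcomp Require Import all_boot all_order all_algebra.
From mathcomp Require Import reals exp.
From mathcomp Require Import zify.

Set Implicit Arguments.
Unset Strict Implicit.
Unset Printing Implicit Defensive.
Import Order.TTheory GRing.Theory Num.Theory.

(* By Roedl's theorem a hook-free graph has a linear set U inducing a very
   sparse graph or a very dense one; up to complementation it is sparse, say of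
   maximum degree e, with e tiny against |U|.  Suppose that U has no
   anticomplete pair of sets of size e.  Then every set of size e has
   neighbours almost everywhere in U, and layer by layer one builds a set J each
   vertex of which starts an induced path of k vertices (its leg), a set A of
   neighbours of J with no edge to the rest of the legs, and a large set W
   anticomplete to J and to all the legs.  If F in W is seen by at least e
   vertices of A, then J and F together dominate almost everything that the legs
   do not touch: otherwise an edge of the undominated part completes a hook
   centred in A.  In particular a second such system (J', A', W') inside W has
   almost no edges from J' and its legs to A.  Now let F grow inside W' until it
   sees e vertices of A or of A'.  It still misses most of the other of these two
   sets, which gives a hook.

   So every large set contains a linear complete or anticomplete pair, and the
   maximum of (clique size) * (independent set size) at least doubles whenever
   the number of vertices is multiplied by a constant. *)

(** * Anticomplete pairs in sparse graphs *)

(** A minimal set with property [Q] loses it when one element is removed. With [Q] a lower bound on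
    a number of neighbours, this stops a growing set just as it crosses the threshold. *)
Lemma minset_step (T : finType) (Q : pred {set T}) (X : {set T}) :
  Q X -> ~~ Q set0 ->
  exists x Y, [/\ x |: Y \subset X, Q (x |: Y) & ~~ Q Y].
Proof.
move=> QX Q0; have [Y /minsetP[QY Ymin] YX] := minset_exists (P := Q) QX.
have [Y0|[x xY]] := set_0Vmem Y; first by rewrite -Y0 QY in Q0.
exists x, (Y :\ x); rewrite setD1K //; split=> //.
apply: contraL (xY) => QYx.
by rewrite -(Ymin _ QYx (subD1set _ _)) !inE eqxx.
Qed.

Lemma subset_of_card (T : finType) (A : {set T}) m :
  m <= #|A| -> exists2 B : {set T}, B \subset A & #|B| = m.
Proof.
move=> /card_geqP[s [us <- sA]]; exists [set x in s].
  by apply/subsetP => x; rewrite inE => /sA.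
by rewrite cardsE (card_uniqP us).
Qed.

Lemma disjoint_setD (T : finType) (A B : {set T}) : [disjoint A :\: B & B].
Proof. by rewrite disjoints_subset subsetDr. Qed.

Lemma adj_neq (G : sgraph) (x y : G) : adj x y -> x != y.
Proof. by apply: contraTneq => ->; rewrite adj_irrefl. Qed.

Definition anticomplete (G : sgraph) (A B : {set G}) : bool :=
  [forall x in A, forall y in B, compl_adj x y].

Section Anticomplete.
Variable G : sgraph.
Implicit Types A B C : {set G}.

Lemma anticompleteP A B :
  reflect {in A & B, forall x y, compl_adj x y} (anticomplete A B).
Proof.
apply: (iffP 'forall_in_forall_inP) => H x; last by move=> xA y yB; apply: H.
by move=> y xA yB; apply: H.
Qed.

Lemma anticompleteC A B : anticomplete A B = anticomplete B A.
Proof.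
by apply/anticompleteP/anticompleteP => H x y xA yB; rewrite compl_adj_sym H.
Qed.

Lemma anticompleteS A B A' B' :
  A' \subset A -> B' \subset B -> anticomplete A B -> anticomplete A' B'.
Proof.
move=> /subsetP sA /subsetP sB /anticompleteP H; apply/anticompleteP.
by move=> x y /sA xA /sB yB; apply: H.
Qed.

Lemma anticompleteUr A B C :
  anticomplete A (B :|: C) = anticomplete A B && anticomplete A C.
Proof.
apply/anticompleteP/andP => [H|[/anticompleteP H1 /anticompleteP H2] x y xA].
  by split; apply/anticompleteP => x y xA yB; rewrite H // inE yB ?orbT.
by rewrite inE => /orP[]; [apply: H1 | apply: H2].
Qed.

Lemma anticomplete_disjoint A B : anticomplete A B -> [disjoint A & B].
Proof.
move=> /anticompleteP H; apply/pred0P => x /=; apply/negP => /andP[xA xB].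
by have := H x x xA xB; rewrite /compl_adj eqxx.
Qed.

End Anticomplete.

(* p_0 = j, ..., p_(k-1) is an induced path; only its first vertex j may lie
   outside Y. *)
Definition leg (G : sgraph) (k : nat) (Y : {set G}) (j : G) : Prop :=
  exists p : nat -> G,
    [/\ p 0 = j, forall i, 0 < i < k -> p i \in Y
      & forall i l, i < l < k -> p i != p l /\ adj (p i) (p l) = (l == i.+1)].

(** The vertex [z] goes in front of the path, of which it sees only [j]; no longer first, [j] has to
    join the set [Y]. *)
Lemma leg_extend (G : sgraph) k (Y : {set G}) (j z : G) :
  leg k Y j -> adj z j -> {in Y, forall y, compl_adj z y} ->
  leg k.+1 (j |: Y) z.
Proof.
move=> [p [p0 pY padj]] zj zY.
exists (fun i => if i is i'.+1 then p i' else z); split=> // [[|[|i]]|] //=.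
- by rewrite p0 !inE eqxx.
- by move=> lik; rewrite !inE pY ?orbT //; lia.
move=> [|i] [|l] //= lt; last first.
  by have [|? ->] := padj i l; first lia.
case: l lt => [|l] lt; first by rewrite p0 adj_neq // zj.
by have /andP[-> /negbTE->] : compl_adj z (p l.+1) by apply/zY/pY; lia.
Qed.

Lemma leg_sub (G : sgraph) k (Y Y' : {set G}) (j : G) :
  Y \subset Y' -> leg k Y j -> leg k Y' j.
Proof.
by move=> /subsetP sY [p [p0 pY padj]]; exists p; split=> // i /pY /sY.
Qed.

(** * Recognising an induced hook *)

Lemma hook_containsP (G : sgraph) (k : nat) (g : nat -> G) :
  (forall i j, i < j < k + 4 -> g i != g j /\
     adj (g i) (g j) = ((i.+1 == j) && (j <= k + 2)) || ((i == k) && (j == k + 3))) ->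
  contains_induced G (hook k).
Proof.
move=> H; exists (fun i : 'I_(k + 4) => g i).
have D (i j : 'I_(k + 4)) : i < j ->
    g i != g j /\ adj (g i) (g j) = hook_adj i j.
  move=> lij; have [|? ->] := H i j; first by rewrite lij /=.
  split=> //; rewrite /hook_adj /hook_arc.
  have -> : (j.+1 == i) = false by lia.
  have -> : (i == k + 3 :> nat) = false by have := ltn_ord j; lia.
  by rewrite andbF /= orbF.
split=> [i j gij|i j].
  apply/val_inj; case: (ltngtP (val i) (val j)) => // /D[].
    by rewrite gij eqxx.
  by rewrite gij eqxx.
case: (ltngtP (val i) (val j)) => [/D[_ ->] //|/D[_ E]|/val_inj ->].
  by rewrite adj_sym E; apply: hook_adj_sym.
by rewrite !adj_irrefl.
Qed.

Lemma contains_hook (G : sgraph) (k : nat) (Y : {set G}) (j v r r' f : G) :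
  0 < k -> leg k Y j -> adj v j -> adj v f -> adj v r -> adj r r' ->
  compl_adj v r' ->
  {in Y, forall y, compl_adj v y} ->
  {in j |: Y, forall y, compl_adj f y} ->
  {in f |: (j |: Y), forall y, compl_adj r y} ->
  {in f |: (j |: Y), forall y, compl_adj r' y} ->
  contains_induced G (hook k).
Proof.
move=> k0 [p [p0 pY padj]] vj vf vr rr' vr' vY fY rY r'Y.
have pjY i : i < k -> p i \in j |: Y.
  by case: i => [|i] ik; rewrite inE ?p0 ?inE ?eqxx // pY ?orbT.
have pfjY i : i < k -> p i \in f |: (j |: Y).
  by move=> ik; rewrite inE pjY ?orbT.
have fj : f \in f |: (j |: Y) by rewrite !inE eqxx.
have nadj (x y : G) : compl_adj x y -> y != x /\ adj y x = false.
  by rewrite compl_adj_sym => /andP[-> /negbTE].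
(* The leg runs backwards, so that [j = p 0] has index [k.-1], next to the centre [v] at index [k];
   the pendant vertex is [f]. *)
pose g i := if i < k then p (k.-1 - i) else nth v [:: v; r; r'; f] (i - k).
apply: (@hook_containsP _ _ g) => i l /andP[lil llk].
have [lk|kl] := ltnP l k.
  rewrite /g lk (ltn_trans lil lk).
  have [|ne E] := padj (k.-1 - l) (k.-1 - i); first lia.
  by rewrite eq_sym ne adj_sym E; split=> //; lia.
have gl : l = k \/ l = k + 1 \/ l = k + 2 \/ l = k + 3 by lia.
have gE d : g (k + d) = nth v [:: v; r; r'; f] d.
  by rewrite /g ltnNge leq_addr addKn.
have gk : g k = v by rewrite -[k]addn0 gE.
have [ik|ki] := ltnP i k.
  have gi : g i = p (k.-1 - i) by rewrite /g ik.
  have ik' : k.-1 - i < k by lia.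
  rewrite gi; case: gl => [->|[->|[->|->]]]; rewrite ?gk ?gE /=.
  - have [e|ne] := eqVneq i.+1 k.
      have -> : k.-1 - i = 0 by lia.
      by rewrite p0 eq_sym adj_neq // adj_sym vj; split=> //; lia.
    have /nadj[-> ->] : compl_adj v (p (k.-1 - i)) by apply/vY/pY; lia.
    by split=> //; lia.
  - by have /nadj[-> ->] := rY _ (pfjY _ ik'); split=> //; lia.
  - by have /nadj[-> ->] := r'Y _ (pfjY _ ik'); split=> //; lia.
  - by have /nadj[-> ->] := fY _ (pjY _ ik'); split=> //; lia.
have [rf rf'] := nadj _ _ (rY _ fj); have [r'f r'f'] := nadj _ _ (r'Y _ fj).
have [vr1 vr2] := nadj _ _ vr'.
rewrite eq_sym in rf; rewrite eq_sym in r'f; rewrite eq_sym in vr1.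
rewrite adj_sym in rf'; rewrite adj_sym in r'f'; rewrite adj_sym in vr2.
have [a ea] : exists a, i = k + a by exists (i - k); rewrite subnKC.
have [b eb] : exists b, l = k + b by exists (l - k); rewrite subnKC.
move: lil llk; rewrite {}ea {}eb ltn_add2l ltn_add2l => ab b4.
have -> : (k + a == k) = (a == 0) by rewrite -{2}[k]addn0 eqn_add2l.
rewrite -addnS !eqn_add2l leq_add2l !gE.
clear -ab b4 rf rf' r'f r'f' vr1 vr2 vf vr rr'.
by case: b b4 ab => [|[|[|[|b]]]] //; case: a => [|[|[|a]]] //= _ _;
  rewrite ?rf ?rf' ?r'f ?r'f' ?vr1 ?vr2 ?vf ?vr ?rr' ?adj_neq.
Qed.

(** * Layered growth in a sparse set without large anticomplete pairs *)

Section Sparse.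
Variables (G : sgraph) (U : {set G}) (e : nat).
Implicit Types A B D F J R W X Y Z : {set G}.

Definition nbrs X : {set G} := [set y in U | [exists x in X, adj x y]].

Lemma in_nbrs X y :
  reflect (y \in U /\ exists2 x, x \in X & adj x y) (y \in nbrs X).
Proof.
rewrite inE; apply: (iffP andP) => -[yU]; first by move=> /exists_inP.
by move=> h; split=> //; apply/exists_inP.
Qed.

Lemma nbrs0 : nbrs set0 = set0.
Proof.
by apply/eqP/set0Pn => -[y /in_nbrs[_ [x]]]; rewrite inE.
Qed.

Lemma anticomplete_nbrsD W Z :
  W \subset U -> [disjoint W & Z] -> anticomplete (W :\: nbrs Z) Z.
Proof.
move=> /subsetP WU WZ; apply/anticompleteP => w z.
rewrite 2!inE => /andP[wN wW] zZ; apply/andP; split.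
  by apply: contraTneq zZ => <-; rewrite (disjointFr WZ wW).
apply: contra wN => wz; rewrite WU //=.
by apply/exists_inP; exists z => //; rewrite adj_sym.
Qed.

Hypothesis e_gt0 : 0 < e.
Hypothesis deg_le : {in U, forall x, #|[set y in U | adj x y]| <= e}.
Hypothesis coherent :
  forall A B, A \subset U -> B \subset U -> anticomplete A B ->
  e <= #|A| -> #|B| < e.

Lemma card_nbrsU1 x X W :
  x \in U -> #|W :&: nbrs (x |: X)| <= #|W :&: nbrs X| + e.
Proof.
move=> xU; apply: leq_trans (leq_add (leqnn _) (deg_le xU)).
apply: leq_trans (leq_card_setU _ _); apply/subset_leq_card/subsetP => y.
rewrite inE => /andP[yW /in_nbrs[yU [z /setU1P[->|zX] zy]]].
  by rewrite !inE yU zy orbT.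
by rewrite inE; apply/orP; left; rewrite inE yW; apply/in_nbrs; split=> //; exists z.
Qed.

Lemma card_uncovered Z W :
  Z \subset U -> W \subset U -> [disjoint W & Z] -> e <= #|Z| ->
  #|W :\: nbrs Z| < e.
Proof.
move=> ZU WU dWZ; apply: coherent => //; last first.
  by rewrite anticompleteC anticomplete_nbrsD.
by rewrite subDset subsetU // WU orbT.
Qed.

(** All of [Z] misses fewer than [e] vertices of [W]. A minimal subset covering [t] of them
    overshoots by less than [e], as its last vertex has degree at most [e]. *)
Lemma partial_cover t Z W :
  0 < t -> Z \subset U -> W \subset U -> [disjoint W & Z] -> e <= #|Z| ->
  t + e <= #|W| ->
  exists2 J : {set G}, J \subset Z & t <= #|W :&: nbrs J| < t + e.
Proof.
move=> t0 ZU WU dWZ eZ tW.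
pose Q J := t <= #|W :&: nbrs J|.
have [||x [J [JZ QJ nQJ]]] := @minset_step _ Q Z.
- have := card_uncovered ZU WU dWZ eZ; have := cardsID (nbrs Z) W.
  by rewrite /Q; lia.
- by rewrite /Q nbrs0 setI0 cards0 -ltnNge.
exists (x |: J) => //.
have xU : x \in U by apply: (subsetP ZU); apply: (subsetP JZ); rewrite !inE eqxx.
by have := card_nbrsU1 J W xU; move: QJ nQJ; rewrite /Q -ltnNge; lia.
Qed.

Variable k : nat.
Hypothesis k_gt0 : 0 < k.
Hypothesis hook_free : ~ contains_induced G (hook k).

(* A vertex of D has neighbours j in J and f in F.  If it saw one end only of
   an edge of R, it would be the degree-three vertex of a hook with legs
   through j, through that edge, and to f; so its neighbourhood in R is a union
   of components of R. *)
Lemma fork_free Y J F D R :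
  (forall j, j \in J -> leg k Y j) ->
  F \subset U -> D \subset nbrs J :&: nbrs F -> R \subset U ->
  anticomplete F (J :|: Y) -> anticomplete D Y ->
  anticomplete R (F :|: (J :|: Y)) ->
  3 * e <= #|R| -> #|D| < e.
Proof.
move=> legJ FU sD RU aF aD aR eR; rewrite ltnNge; apply/negP => eD.
have DU : D \subset U by apply/subsetP => x /(subsetP sD); rewrite !inE => /andP[/andP[]].
have split D' r r' : D' \subset D -> r \in R -> r' \in R ->
    r \in nbrs D' -> adj r r' -> r' \in nbrs D'.
  move=> sD' rR r'R /in_nbrs[rU [v vD' vr]] rr'; apply/in_nbrs.
  split; first exact: (subsetP RU).
  exists v => //; apply/negPn/negP => nvr'; apply: hook_free.
  have vD := subsetP sD' _ vD'.
  have /setIP[/in_nbrs[_ [j jJ jv]] /in_nbrs[_ [f fF fv]]] := subsetP sD _ vD.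
  have jfY : f |: (j |: Y) \subset F :|: (J :|: Y).
    by rewrite setUSS ?sub1set // setUSS // sub1set.
  have toR x : x \in R -> {in f |: (j |: Y), forall y, compl_adj x y}.
    by move=> xR y /(subsetP jfY); apply: (anticompleteP _ _ aR).
  have vr'ne : v != r'.
    apply: contraTneq jv => ->; rewrite adj_sym.
    by have /andP[] : compl_adj r' j by apply: toR => //; rewrite !inE eqxx orbT.
  apply: (contains_hook k_gt0 (legJ j jJ) _ _ vr rr' _ _ _ (toR r rR) (toR r' r'R)).
  - by rewrite adj_sym.
  - by rewrite adj_sym.
  - by rewrite /compl_adj vr'ne.
  - by move=> y yY; apply: (anticompleteP _ _ aD).
  - move=> y yjY; apply: (anticompleteP _ _ aF) => //.
    by apply: subsetP yjY; rewrite setUSS // sub1set.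
have dRD : [disjoint R & D].
  apply/pred0P => x /=; apply/negP => /andP[xR /(subsetP sD)].
  rewrite inE => /andP[/in_nbrs[_ [j jJ jx]] _].
  have /andP[_] : compl_adj x j.
    by apply: (anticompleteP _ _ aR) => //; rewrite !inE jJ orbT.
  by rewrite adj_sym jx.
(* [D'] covers at least [e] and fewer than [2 * e] vertices of [R]. By [split] these are
   anticomplete to the uncovered ones, which are therefore fewer than [e]. *)
have [||||||D' D'D /andP[eRD' RD'e]] := @partial_cover e D R => //; first lia.
suff : #|R :\: nbrs D'| < e.
  by have := cardsID (nbrs D') R; clear -eR RD'e; lia.
apply: (@coherent (R :&: nbrs D')) => //.
- by rewrite subIset // RU.
- by rewrite subDset subsetU // RU orbT.
apply/anticompleteP => r r'; rewrite !in_setI in_setD => /andP[rR rN] /andP[r'N r'R].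
apply/andP; split; first by apply: contraNneq r'N => <-.
by apply: contra r'N => /split; apply.
Qed.

(** [Z] is the front layer. A part [J] of it with at least [e] and fewer than [2 * e] neighbours in
    [W] moves into [Y]; these neighbours leave [W] and form the next front. The first layer costs
    [e], each later one at most [2 * e]. [W] may still see [Z]: the legs continue from there. *)
Lemma legs_exist i W0 :
  W0 \subset U -> (2 * i + 1) * e <= #|W0| ->
  exists Y Z W,
    [/\ Y \subset W0 /\ Z \subset W0, W \subset W0,
        (forall z, z \in Z -> leg i.+1 Y z), anticomplete W Y
      & [/\ [disjoint W & Z], e <= #|Z| & #|W0| <= #|W| + (2 * i + 1) * e]].
Proof.
move=> W0U; elim: i => [|i IH] sz.
  have [|Z ZW0 cZ] := @subset_of_card _ W0 e; first lia.
  exists set0, Z, (W0 :\: Z); split=> //.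
  - by rewrite sub0set.
  - exact: subsetDl.
  - by move=> z _; exists (fun=> z); split=> // [i|i l]; lia.
  - by apply/anticompleteP => x y _; rewrite inE.
  split; first exact: disjoint_setD.
    by rewrite cZ.
  by have := cardsID Z W0; rewrite (setIidPr ZW0); lia.
have [|Y [Z [W [[YW0 ZW0] WW0 legZ aWY [dWZ eZ szW]]]]] := IH; first lia.
have [||||||J JZ /andP[eJ Je]] := @partial_cover e Z W => //; try exact: subset_trans W0U.
  lia.
exists (J :|: Y), (W :&: nbrs J), (W :\: nbrs J); split.
- by rewrite subUset YW0 (subset_trans JZ ZW0) subIset ?WW0.
- exact: subset_trans (subsetDl _ _) WW0.
- move=> z /setIP[zW /in_nbrs[_ [j jJ jz]]].
  apply: (@leg_sub _ _ (j |: Y)); first by rewrite setUSS // sub1set.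
  apply: leg_extend; first by apply/legZ/(subsetP JZ).
    by rewrite adj_sym.
  by move=> y yY; apply: (anticompleteP _ _ aWY).
- rewrite anticompleteUr anticomplete_nbrsD ?(subset_trans WW0) //.
    by rewrite (anticompleteS (subsetDl _ _) (subxx _) aWY).
  by rewrite disjoint_sym (disjointWl JZ) // disjoint_sym.
split=> //.
  exact: disjointWr (subsetIr _ _) (disjoint_setD _ _).
by have := cardsID (nbrs J) W; lia.
Qed.

(** One more layering step, with target [t] instead of [e]: the covered vertices become [A], and the
    rest of [W] no longer sees [J]. The legs cost [(2 * k.-1 + 1) * e], this step at most
    [t + e]. *)
Lemma leg_cover t W0 :
  0 < t -> W0 \subset U -> 2 * k * e + t <= #|W0| ->
  exists Y J A W,
    [/\ J :|: Y \subset W0, A \subset W0 :&: nbrs J, W \subset W0,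
        (forall j, j \in J -> leg k Y j)
      & [/\ anticomplete A Y, anticomplete W (J :|: Y), [disjoint W & A],
            t <= #|A| & #|W0| <= #|W| + 2 * k * e + t]].
Proof.
move=> t0 W0U sz.
have ke : k.-1 * e + e = k * e by rewrite -mulSnr prednK.
have [||Y [Z [W [[YW0 ZW0] WW0 legZ aWY [dWZ eZ szW]]]]] :=
  @legs_exist k.-1 W0 => //; first lia.
rewrite prednK // in legZ.
have [||||||J JZ /andP[eJ Je]] := @partial_cover t Z W => //; try exact: subset_trans W0U.
  lia.
exists Y, J, (W :&: nbrs J), (W :\: nbrs J); split.
- by rewrite subUset YW0 (subset_trans JZ ZW0).
- by rewrite setSI.
- exact: subset_trans (subsetDl _ _) WW0.
- by move=> j /(subsetP JZ)/legZ.
split=> //.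
- exact: anticompleteS (subsetIl _ _) (subxx _) aWY.
- rewrite anticompleteUr anticomplete_nbrsD ?(subset_trans WW0) //.
    by rewrite (anticompleteS (subsetDl _ _) (subxx _) aWY).
  by rewrite disjoint_sym (disjointWl JZ) // disjoint_sym.
- exact: disjointWr (subsetIr _ _) (disjoint_setD _ _).
by have := cardsID (nbrs J) W; lia.
Qed.

(** Two systems with target [6 * e] cost [(2 * k + 6) * e] each, and [3 * e] vertices remain for the
    set [R] of [fork_free]. The target [6 * e] leaves enough for [R] after a loss of [e] to the
    second system and of [2 * e] to the growing set. *)
Lemma coherent_bound : #|U| < (4 * k + 15) * e.
Proof.
rewrite ltnNge; apply/negP => szU.
have e6 : 0 < 6 * e by rewrite muln_gt0.
have [||Y1 [J1 [A1 [W1 [_ A1J W1U leg1 [aAY1 aWJY1 dWA1 tA1 szW1]]]]]] :=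
  leg_cover e6 (W0 := U); [by [] | by lia |].
have szW1' : 2 * k * e + 9 * e <= #|W1| by clear -szU szW1; lia.
have [||Y2 [J2 [A2 [W2 [JYW2 A2J W2W1 leg2 [aAY2 aWJY2 dWA2 tA2 szW2]]]]]] :=
  leg_cover e6 (W0 := W1); [by [] | by clear -szW1'; lia |].
have {szU szW1 szW1' szW2} szW2 : 3 * e <= #|W2| by clear -szW1' szW2; lia.
have W2U := subset_trans W2W1 W1U.
have A1U : A1 \subset U by apply: subset_trans A1J (subsetIl _ _).
have A2W1 : A2 \subset W1 by apply: subset_trans A2J (subsetIl _ _).
have A1n : A1 \subset nbrs J1 by apply: subset_trans A1J (subsetIr _ _).
have A2n : A2 \subset nbrs J2 by apply: subset_trans A2J (subsetIr _ _).
have anti1 X : X \subset W1 -> anticomplete X (J1 :|: Y1).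
  by move=> XW; apply: anticompleteS XW (subxx _) aWJY1.
have anti2 X : X \subset W2 -> anticomplete X (J2 :|: Y2).
  by move=> XW; apply: anticompleteS XW (subxx _) aWJY2.
(* For the first system, [J2 :|: Y2] plays the part of [F] in [fork_free], and [W2] that of [R]. *)
have small : #|A1 :&: nbrs (J2 :|: Y2)| < e.
  apply: (@fork_free Y1 J1 (J2 :|: Y2) _ W2) => //.
  - exact: subset_trans JYW2 W1U.
  - by rewrite setSI.
  - exact: anti1.
  - exact: anticompleteS (subsetIl _ _) (subxx _) aAY1.
  - by rewrite anticompleteUr aWJY2 anti1.
pose B1 := A1 :\: nbrs (J2 :|: Y2).
have szB1 : 5 * e < #|B1|.
  by have := cardsID (nbrs (J2 :|: Y2)) A1; rewrite -/B1; clear -small tA1; lia.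
have B1A1 : B1 \subset A1 := subsetDl _ _.
have B1U : B1 \subset U by apply: subset_trans B1A1 A1U.
have dW2 X : X \subset W2 -> [disjoint A1 & X] /\ [disjoint A2 & X].
  move=> XW; split; rewrite disjoint_sym.
    by apply: disjointWl dWA1; apply: subset_trans W2W1.
  exact: disjointWl dWA2.
have dB1 X : X \subset W2 -> [disjoint B1 & X].
  by move=> /dW2[dA _]; apply: disjointWl dA.
have antiB1 : anticomplete B1 (J2 :|: Y2).
  apply: anticomplete_nbrsD => //; rewrite disjoint_sym.
  by apply: disjointWl dWA1; apply: JYW2.
(* Whichever of B1 and A2 the growing set F sees first, most of the other one is
   still unseen, so that fork_free applies to the system of the first one. *)
pose Q F := (e <= #|B1 :&: nbrs F|) || (e <= #|A2 :&: nbrs F|).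
have [||x [F [FW2 QF nQF]]] := @minset_step _ Q W2.
- have eW2 : e <= #|W2| by clear -szW2; lia.
  have := card_uncovered W2U B1U (dB1 _ (subxx _)) eW2.
  have := cardsID (nbrs W2) B1; rewrite /Q; clear -szB1 szW2 e_gt0; lia.
- by rewrite /Q nbrs0 !setI0 cards0 negb_or -!ltnNge e_gt0.
have xU : x \in U by apply: (subsetP W2U); apply: (subsetP FW2); rewrite !inE eqxx.
have := card_nbrsU1 F B1 xU; have := card_nbrsU1 F A2 xU.
move: nQF; rewrite /Q negb_or -!ltnNge => /andP[nF1 nF2].
set F' := x |: F in FW2 QF *; move=> nF2' nF1'.
(* Before [x] was added both counts were below [e], and [x] adds at most [e] to each. *)
have {}nF2' : #|A2 :&: nbrs F'| < 2 * e by clear -nF2 nF2'; lia.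
have {}nF1' : #|B1 :&: nbrs F'| < 2 * e by clear -nF1 nF1'; lia.
have FU := subset_trans FW2 W2U; have FW1 := subset_trans FW2 W2W1.
have [dA1 dA2] := dW2 _ FW2; have dB := dB1 _ FW2.
have A2U := subset_trans A2W1 W1U.
case/orP: QF; apply/negP; rewrite -ltnNge.
  apply: (@fork_free Y1 J1 F' _ (A2 :\: nbrs F')) => //.
  - by apply: setSI; apply: subset_trans A1n.
  - exact: subset_trans (subsetDl _ _) A2U.
  - exact: anti1.
  - apply: anticompleteS _ (subxx _) aAY1.
    exact: subset_trans (subsetIl _ _) B1A1.
  - rewrite anticompleteUr anticomplete_nbrsD // anti1 //.
    exact: subset_trans (subsetDl _ _) A2W1.
  by have := cardsID (nbrs F') A2; clear -nF2' tA2; lia.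
(* Here [R] must not see the second system; this is why [A1] was cut down to [B1]. *)
apply: (@fork_free Y2 J2 F' _ (B1 :\: nbrs F')) => //.
- exact: setSI.
- exact: subset_trans (subsetDl _ _) B1U.
- exact: anti2.
- exact: anticompleteS (subsetIl _ _) (subxx _) aAY2.
- rewrite anticompleteUr anticomplete_nbrsD //.
  exact: anticompleteS (subsetDl _ _) (subxx _) antiB1.
by have := cardsID (nbrs F') B1; clear -nF1' szB1; lia.
Qed.

End Sparse.

Lemma sparse_pair (G : sgraph) (U : {set G}) (e k : nat) :
  0 < k -> ~ contains_induced G (hook k) -> 0 < e ->
  {in U, forall x, #|[set y in U | adj x y]| <= e} ->
  (4 * k + 15) * e <= #|U| ->
  exists A B : {set G},
    [/\ A \subset U, B \subset U, anticomplete A B, e <= #|A| & e <= #|B|].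
Proof.
move=> k0 nH e0 deg szU.
have [/existsP[A /existsP[B /and5P[]]]|nE] := boolP [exists A : {set G},
  exists B : {set G}, [&& A \subset U, B \subset U, anticomplete A B,
  e <= #|A| & e <= #|B|]]; first by exists A, B.
suff : #|U| < (4 * k + 15) * e by lia.
apply: coherent_bound => // A B AU BU aAB eA; rewrite ltnNge.
apply: contra nE => eB; apply/existsP; exists A; apply/existsP; exists B.
by rewrite AU BU aAB eA.
Qed.

(** * Roedl's theorem *)

(** Deleting an element with the largest value of [f] does not raise the average; denominators are
    cleared. *)
Lemma below_average_subset (T : finType) (f : T -> nat) (B : {set T}) m :
  m <= #|B| -> exists B' : {set T},
    [/\ B' \subset B, #|B'| = m
      & #|B| * \sum_(x in B') f x <= m * \sum_(x in B) f x].
Proof.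
move eb: #|B| => b; elim: b B eb => [|b IH] B eb mb.
  by exists B; rewrite eb; split=> //; lia.
move: mb; rewrite leq_eqVlt => /predU1P[->|mb]; first by exists B; rewrite eb.
have [x0 x0B] : exists x, x \in B by apply/set0Pn; rewrite -card_gt0 eb.
case: (@arg_maxnP _ x0 (mem B) f x0B) => x xB xmax.
have eb1 : #|B :\ x| = b by have := cardsD1 x B; rewrite (xB : x \in B) eb => -[].
have [B' [B'B cB' le]] := IH _ eb1 mb.
exists B'; split=> //; first exact: subset_trans B'B (subD1set _ _).
have ltm : \sum_(y in B :\ x) f y <= b * f x.
  rewrite -eb1 -sum_nat_const; apply: leq_sum => y /setD1P[_ yB].
  exact: xmax.
have [b0|b0] := posnP b.
  have /cards0_eq-> : #|B'| = 0 by rewrite cB'; clear -mb b0; lia.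
  by rewrite big_set0 muln0.
rewrite [X in _ <= m * X](big_setD1 x) //=; move: le ltm.
move: (\sum_(y in B') _) (\sum_(y in B :\ x) _) (f x) => s1 s2 y le ltm.
rewrite -(leq_pmul2l b0).
apply: (@leq_trans (b.+1 * (m * s2))); first by rewrite mulnCA leq_mul2l le.
have -> : b.+1 * (m * s2) = m * (b * s2 + s2) by lia.
by rewrite mulnCA leq_mul2l mulnDr addnC leq_add2r ltm orbT.
Qed.

Lemma disjoint_family (T I : finType) (X : {set T}) (s : seq I) N :
  size s * N <= #|X| -> exists C : I -> {set T},
    {in s, forall i, C i \subset X /\ #|C i| = N} /\
    {in s &, forall i j, i != j -> [disjoint C i & C j]}.
Proof.
elim: s X => [|i s IH] X /= sz; first by exists (fun=> set0); split=> ?.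
have [|D DX cD] := @subset_of_card _ X N; first by lia.
have [|C [CX Cd]] := IH (X :\: D).
  by have := cardsID D X; rewrite (setIidPr DX) cD; lia.
exists (fun j => if j == i then D else C j); split=> [j|j l].
  rewrite inE; case: eqP => //= _ /CX[CXD ->]; split=> //.
  exact: subset_trans CXD (subsetDl _ _).
have dD l' : l' \in s -> [disjoint D & C l'].
  move=> /CX[]; rewrite disjoint_sym subsetD => /andP[_ ?] _ //.
rewrite !inE; case: (eqVneq j i) => [->|ji]; case: (eqVneq l i) => [->|li] //=.
- by move=> _ /dD.
- by move=> /dD; rewrite disjoint_sym.
exact: Cd.
Qed.

(** * Edge counts and families with sparse pairs *)

Section Edges.
Variables (T : finType) (r : rel T).
Implicit Types A B C : {set T}.

(** Ordered pairs are counted, so for an adjacency relation [edges U U] is twice the number of edges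
    inside [U]. *)
Definition edges A B : nat := \sum_(x in A) #|[set y in B | r x y]|.

Lemma edges_swap A B : edges A B = \sum_(y in B) #|[set x in A | r x y]|.
Proof.
rewrite /edges.
under eq_bigr => x _ do rewrite -sum1_card.
under [RHS]eq_bigr => x _ do rewrite -sum1_card.
rewrite (exchange_big_dep (mem B)) /=; last by move=> x y _; rewrite inE => /andP[].
apply: eq_bigr => y yB; apply: eq_bigl => x; by rewrite !inE yB.
Qed.

Lemma edges_sym A B : symmetric r -> edges A B = edges B A.
Proof.
move=> rs; rewrite edges_swap; apply: eq_bigr => y _.
by apply: eq_card => x; rewrite !inE rs.
Qed.

Lemma edges_sub A A' B B' :
  A' \subset A -> B' \subset B -> edges A' B' <= edges A B.
Proof.
move=> sA sB; rewrite /edges [X in _ <= X](big_setID A') (setIidPr sA) /=.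
apply: leq_trans (leq_addr _ _); apply: leq_sum => x _.
by apply/subset_leq_card/subsetP => y; rewrite !inE => /andP[/(subsetP sB)-> ->].
Qed.

Lemma edges_le A B : edges A B <= #|A| * #|B|.
Proof.
rewrite -sum_nat_const; apply: leq_sum => x _.
by apply/subset_leq_card/subsetP => y; rewrite inE => /andP[].
Qed.

Lemma edgesUr A B C : edges A (B :|: C) <= edges A B + edges A C.
Proof.
rewrite -big_split; apply: leq_sum => x _ /=.
apply: leq_trans (leq_card_setU _ _); apply/subset_leq_card/subsetP => y.
by rewrite !inE => /andP[/orP[]-> ->]; rewrite ?orbT.
Qed.

(** Distinct members have density at most [1 / q] between them. Edges inside a member are
    unrestricted: their share is small when there are many members. *)
Definition sparse_family q m (L : seq {set T}) : bool :=
  all (fun S : {set T} => #|S| == m) L &&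
  pairwise (fun S S' : {set T} => [disjoint S & S'] && (q * edges S S' <= m * m)) L.

(** The factor [M * M] makes the edges between [A] and [B] so few that, even if all of them joined
    the same two members, the density there would be at most [1 / q]. *)
Lemma sparse_family_cat M q m A B L L' :
  0 < M -> [disjoint A & B] -> q * M * M * edges A B <= M * m * (M * m) ->
  {in L, forall S : {set T}, S \subset A} -> {in L', forall S : {set T}, S \subset B} ->
  sparse_family q m L -> sparse_family q m L' -> sparse_family q m (L ++ L').
Proof.
move=> M0 dAB eAB LA LB /andP[cL pL] /andP[cL' pL'].
rewrite /sparse_family all_cat cL cL' pairwise_cat pL pL' /= !andbT.
apply/allrelP => S S' /LA SA /LB SB; apply/andP; split.
  exact: disjointWl SA (disjointWr SB dAB).
have le := edges_sub SA SB.
rewrite -(@leq_pmul2l (M * M)) ?muln_gt0 ?M0 //.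
rewrite [X in _ <= X]mulnACA; apply: leq_trans eAB.
have -> : M * M * (q * edges S S') = q * M * M * edges S S'.
  by rewrite [M * M * _]mulnC -!mulnA; congr (_ * _); rewrite mulnC mulnA.
by rewrite leq_mul2l le orbT.
Qed.

(** The inside of a member contributes at most [m * m] to the edge count, an ordered pair of
    distinct members at most [m * m / q]. *)
Lemma sparse_family_union q m L :
  symmetric r -> sparse_family q m L ->
  let U := \bigcup_(S <- L) S in
  #|U| = size L * m /\
  q * edges U U <= size L * (q * (m * m)) + size L * size L * (m * m).
Proof.
move=> rs; elim: L => [|S L IH] /=.
  by rewrite big_nil cards0 => _; split=> //; rewrite /edges big_set0 muln0.
case/andP=> /= /andP[/eqP cS cL] /andP[/allP pS pL].
have [|cU eU] := IH; first exact/andP.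
rewrite !big_cons; set U := \bigcup_(S <- L) S in cU eU *.
have {}pS : [disjoint S & U] /\ q * edges S U <= size L * (m * m).
  rewrite /U {IH U cU eU cL pL}; elim: L pS => [|S' L IH] pS.
    rewrite big_nil /edges disjoint_sym disjoints_subset sub0set; split=> //.
    rewrite big1 ?muln0 // => x _; apply/eqP; rewrite cards_eq0; apply/eqP.
    by apply/setP => y; rewrite !inE.
  have [|dS eS] := IH; first by move=> A AL; apply: pS; rewrite inE AL orbT.
  have /andP[dS' eS'] := pS S' (mem_head _ _).
  rewrite big_cons /=; split.
    by rewrite disjoints_subset setCU subsetI -!disjoints_subset dS' dS.
  apply: (@leq_trans (q * (edges S S' + edges S (\bigcup_(A <- L) A)))).
    by rewrite leq_mul2l edgesUr orbT.
  by rewrite mulnDr mulSn leq_add.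
case: pS => dS eS; split.
  by rewrite cardsU (disjoint_setI0 dS) cards0 subn0 cS cU mulSn.
have le : edges (S :|: U) (S :|: U) <= m * m + 2 * edges S U + edges U U.
  apply: (leq_trans (edgesUr _ _ _)).
  rewrite [edges _ S]edges_sym // [edges _ U]edges_sym //.
  have := edgesUr S S U; have := edgesUr U S U; have := edges_le S S.
  by rewrite cS [edges U S]edges_sym //; lia.
apply: (@leq_trans (q * (m * m + 2 * edges S U + edges U U))).
  by rewrite leq_mul2l le orbT.
move: (edges S U) (edges U U) (size L) eS eU => a b l eS eU; clear -eS eU.
lia.
Qed.

End Edges.

(** Greedy embedding: [x] goes to some [v] in [C x], and each later candidate set keeps the vertices
    with the right adjacency to [v]. The power of [q] pays for one shrinking per embedded vertex,
    the factor [#|H|] for a pigeonhole over the sets that may shrink too much. [f0] supplies the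
    values off [s]. *)
Lemma embed_or_pair (G H : sgraph) (f0 : H -> G) q m (s : seq H)
    (C : H -> {set G}) :
  0 < q -> 0 < m -> uniq s -> size s <= #|H| ->
  {in s, forall x, #|H| * q ^ size s * m <= #|C x|} ->
  (exists f : H -> G, {in s, forall x, f x \in C x} /\
     {in s &, forall x y, x != y -> adj (f x) (f y) = adj x y}) \/
  (exists x y, [/\ x \in s, y \in s, x != y &
     exists A B : {set G}, [/\ A \subset C x, B \subset C y, #|A| = m, m <= #|B|
     & q * edges (@adj G) A B <= m * #|B| \/
       q * edges (@compl_adj G) A B <= m * #|B|]]).
Proof.
move=> q0 m0; elim: s C => [|x s IH] C /=.
  by move=> _ _ _; left; exists f0.
move=> /andP[xs us] szs szC.
pose C' v y := [set w in C y | adj v w == adj x y].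
have C'C v y : C' v y \subset C y by apply/subsetP => w; rewrite inE => /andP[].
have [/exists_inP[v vC /allP good]|bad] :=
  boolP [exists v in C x, all (fun y => #|C y| <= q * #|C' v y|) s].
  have [||y ys|[f [fC fadj]]|[y [z [ys zs yz [A [B [AC BC cA cB eAB]]]]]]] :=
    IH (C' v).
  - by [].
  - exact: ltnW.
  - rewrite -(leq_pmul2l q0); apply: leq_trans (good y ys).
    apply: leq_trans (szC y _); last by rewrite inE ys orbT.
    by rewrite expnS -!mulnA [q * (#|H| * _)]mulnCA.
  - left; exists (fun y => if y == x then v else f y).
    have fC' y : y \in s -> f y \in C y /\ adj v (f y) = adj x y.
      by move=> /fC; rewrite inE => /andP[? /eqP].
    split=> [y|y z]; rewrite !inE.
      by case: eqVneq => [->|_ /fC'[]].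
    case: (eqVneq y x) => [->|yx]; case: (eqVneq z x) => [->|zx] //=.
    + by move=> _ /fC'[].
    + by move=> /fC'[_ +] _ _; rewrite adj_sym => ->; apply: adj_sym.
    + exact: fadj.
  right; exists y, z; rewrite !inE ys zs yz !orbT; split=> //.
  by exists A, B; split=> //; [exact: subset_trans AC _|exact: subset_trans BC _].
(* [D y] collects the choices of [v] that shrink [C y] too much. If there are [m] of them, they are
   sparse to [C y] in the graph when [x] and [y] are adjacent, in the complement otherwise. *)
pose D y := [set v in C x | q * #|C' v y| < #|C y|].
have [/hasP[y ys mD]|small] := boolP (has (fun y => m <= #|D y|) s).
  have [A AD cA] := subset_of_card mD.
  have xy : x != y by apply: contraNneq xs => ->.
  right; exists x, y; rewrite !inE eqxx ys orbT; split=> //.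
  exists A, (C y); split=> //.
  - by apply: subset_trans AD _; apply/subsetP => v; rewrite inE => /andP[].
  - apply: leq_trans (szC y _); last by rewrite inE ys orbT.
    by rewrite leq_pmull // muln_gt0 expn_gt0 q0 andbT (leq_trans _ szs).
  have le (r : rel G) : {in A, forall v, #|[set w in C y | r v w]| <= #|C' v y|} ->
      q * edges r A (C y) <= m * #|C y|.
    move=> rC; rewrite -cA -sum_nat_const /edges big_distrr /=.
    apply: leq_sum => v vA; have := subsetP AD v vA.
    rewrite inE => /andP[_ /ltnW]; apply: leq_trans.
    by rewrite leq_mul2l rC ?orbT.
  case E: (adj x y); [left|right]; apply: le => v vA;
    apply/subset_leq_card/subsetP => w; rewrite !inE E => /andP[-> /=].
    by move=> ->.
  by move=> /andP[_ /negbTE->].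
(* Otherwise fewer than [#|H|] sets [D y], each with fewer than [m] elements, cover [C x], which is
   too large for that. *)
have cov : C x \subset \bigcup_(y <- s) D y.
  apply/subsetP => v vC.
  have := bad; rewrite negb_exists_in => /forall_inP /(_ v vC).
  rewrite -has_predC => /hasP[y ys /=]; rewrite -ltnNge => lt.
  by rewrite bigcup_seq; apply/bigcupP; exists y => //; rewrite inE vC.
have : #|C x| <= size s * m.
  apply: leq_trans (subset_leq_card cov) _.
  move: small; rewrite -all_predC => /allP small; clear -small.
  elim: s small => [|y s IH] small; first by rewrite big_nil cards0.
  rewrite big_cons mulSn; apply: leq_trans (leq_card_setU _ _) _.
  apply: leq_add; first by apply: ltnW; rewrite ltnNge; apply: small (mem_head _ _).
  by apply: IH => z zs; apply: small; rewrite inE zs orbT.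
rewrite leqNgt => /negP[]; apply: leq_trans (szC x (mem_head _ _)).
rewrite expnS; apply: (@leq_trans (#|H| * m)); first by rewrite ltn_mul2r m0.
by rewrite leq_mul2r leq_pmulr ?orbT // muln_gt0 expn_gt0 q0.
Qed.

(** With disjoint candidate sets an embedding would be injective, hence an induced copy of [H]. So
    [embed_or_pair] yields a pair, whose second side is trimmed to size [m] by averaging. *)
Lemma sparse_or_dense_pair (G H : sgraph) q m (X : {set G}) :
  ~ contains_induced G H -> 0 < q -> 0 < m -> 0 < #|H| ->
  #|H| * (#|H| * q ^ #|H| * m) <= #|X| ->
  exists A B : {set G},
    [/\ A \subset X, B \subset X, [disjoint A & B], #|A| = m /\ #|B| = m
      & q * edges (@adj G) A B <= m * m \/
        q * edges (@compl_adj G) A B <= m * m].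
Proof.
move=> nH q0 m0 h0 szX.
have szH : size (enum H) = #|H| by rewrite -cardE.
have [|C [CX Cd]] := @disjoint_family G H X (enum H) (#|H| * q ^ #|H| * m).
  by rewrite szH.
have inH x : x \in enum H by rewrite mem_enum.
have [v vX] : exists v, v \in X.
  apply/set0Pn; rewrite -card_gt0; apply: leq_trans szX.
  by rewrite !muln_gt0 h0 expn_gt0 q0 m0.
have [||||x _|[f [fC fadj]]|] := @embed_or_pair G H (fun=> v) q m (enum H) C => //.
- exact: enum_uniq.
- by rewrite szH.
- by have [_ ->] := CX x (inH x); rewrite szH.
- case: nH; exists f; split=> [x y fxy|x y].
    apply/eqP/negPn/negP => xy.
    have := disjointFr (Cd x y (inH x) (inH y) xy) (fC x (inH x)).
    by rewrite fxy fC.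
  by case: (eqVneq x y) => [->|/fadj-> //]; rewrite ?adj_irrefl.
case=> x [y [_ _ xy [A [B [AC BC cA mB eAB]]]]].
have dAB : [disjoint A & B].
  exact: disjointWl AC (disjointWr BC (Cd x y (inH x) (inH y) xy)).
have AX : A \subset X by apply: subset_trans AC (CX x (inH x)).1.
have BX : B \subset X by apply: subset_trans BC (CX y (inH y)).1.
have B0 : 0 < #|B| by apply: leq_trans mB.
have avg (r : rel G) : q * edges r A B <= m * #|B| -> exists B' : {set G},
    [/\ B' \subset B, #|B'| = m & q * edges r A B' <= m * m].
  move=> le; have [B' [B'B cB' le']] :=
    below_average_subset (fun y => #|[set x in A | r x y]|) mB.
  exists B'; split=> //; rewrite -(leq_pmul2l B0).
  rewrite -!edges_swap in le'.
  rewrite mulnCA; apply: (@leq_trans (q * (m * edges r A B))).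
    by rewrite leq_mul2l le' orbT.
  by rewrite mulnCA [X in _ <= X]mulnCA leq_mul2l [#|B| * m]mulnC le orbT.
case: eAB => /avg[B' [B'B cB' eAB']]; exists A, B'; split=> //.
- exact: subset_trans B'B BX.
- exact: disjointWr B'B dAB.
- by left.
- exact: subset_trans B'B BX.
- exact: disjointWr B'B dAB.
- by right.
Qed.

(* Doubling: a sparse pair concatenates the sparse families found in its two
   sides and keeps the larger dense one, and symmetrically; as
   (s + s') * max(d, d') >= s d + s' d', the product of the two sizes doubles. *)
Lemma sparse_dense_families (H : sgraph) t q :
  0 < #|H| -> 0 < q -> exists2 M, 0 < M &
  forall (G : sgraph) m (X : {set G}),
    ~ contains_induced G H -> 0 < m -> M * m <= #|X| ->
    exists L1 L2 : seq {set G},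
      [/\ sparse_family (@adj G) q m L1, sparse_family (@compl_adj G) q m L2,
          {in L1, forall S : {set G}, S \subset X},
          {in L2, forall S : {set G}, S \subset X}
        & 2 ^ t <= size L1 * size L2].
Proof.
move=> h0; elim: t q => [|t IH] q q0.
  exists 1 => // G m X nH m0; rewrite mul1n => /subset_of_card[S SX cS].
  exists [:: S], [:: S]; rewrite /sparse_family /= cS eqxx.
  by split=> // S'; rewrite inE => /eqP->.
have [M M0 HM] := IH q q0.
(* This is the sparsity that [sparse_family_cat] asks for between sides of size [M * m]. *)
set q' := q * M * M.
have q'0 : 0 < q' by rewrite !muln_gt0 q0 M0.
exists (#|H| * (#|H| * q' ^ #|H| * M)).
  by rewrite !muln_gt0 h0 expn_gt0 q'0 M0.
move=> G m X nH m0; rewrite -!mulnA => szX.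
have [|||A [B [AX BX dAB [cA cB] eAB]]] :=
  @sparse_or_dense_pair G H q' (M * m) X nH q'0.
- by rewrite muln_gt0 M0.
- by [].
- by rewrite -!mulnA.
have [|A1 [A2 [sA1 sA2 A1A A2A szA]]] := HM G m A nH m0; first by rewrite cA.
have [|B1 [B2 [sB1 sB2 B1B B2B szB]]] := HM G m B nH m0; first by rewrite cB.
have inX L1 L2 :
    {in L1, forall S : {set G}, S \subset A} ->
    {in L2, forall S : {set G}, S \subset B} ->
    {in L1 ++ L2, forall S : {set G}, S \subset X}.
  move=> LA LB S; rewrite mem_cat => /orP[/LA SA|/LB SB].
    exact: subset_trans SA AX.
  exact: subset_trans SB BX.
have pick (r : rel G) L L' :
    sparse_family r q m L -> sparse_family r q m L' ->
    {in L, forall S : {set G}, S \subset A} -> {in L', forall S : {set G}, S \subset B} ->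
    exists L'', [/\ sparse_family r q m L'', {in L'', forall S : {set G}, S \subset X},
      size L <= size L'' & size L' <= size L''].
  move=> sL sL' LA LB; case: (leqP (size L) (size L')) => le.
    by exists L'; split=> // S /LB SB; apply: subset_trans SB BX.
  by exists L; split=> // [S /LA SA|]; [apply: subset_trans SA AX | apply: ltnW].
have dbl a b c d x : 2 ^ t <= a * c -> 2 ^ t <= b * d -> c <= x -> d <= x ->
    2 ^ t.+1 <= (a + b) * x.
  move=> le1 le2 cx dx; rewrite expnS mul2n -addnn mulnDl.
  by apply: leq_add; [apply: leq_trans le1 _|apply: leq_trans le2 _];
    rewrite leq_mul2l ?cx ?dx orbT.
case: eAB => eAB.
  have [L [sL LX le1 le2]] := pick _ _ _ sA2 sB2 A2A B2B.
  exists (A1 ++ B1), L; split=> //; first exact: sparse_family_cat eAB _ _ _ _.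
    exact: inX.
  by rewrite size_cat; apply: dbl szA szB le1 le2.
have [L [sL LX le1 le2]] := pick _ _ _ sA1 sB1 A1A B1B.
exists L, (A2 ++ B2); split=> //; first exact: sparse_family_cat eAB _ _ _ _.
  exact: inX.
by rewrite size_cat mulnC; apply: dbl le1 le2; rewrite mulnC.
Qed.

(** In a union of exactly [8 * C] members, the insides and the distinct pairs each contribute at
    most [8 * C * m * m] to the edge count, so at most half of the [8 * C * m] vertices have degree
    above [4 * m]. *)
Lemma low_degree_subset (T : finType) (r : rel T) C m (L : seq {set T}) :
  symmetric r -> 0 < m -> 0 < C -> 
  sparse_family r (8 * C) m L -> 8 * C <= size L ->
  exists U : {set T},
    [/\ U \subset \bigcup_(S <- L) S, C * (4 * m) <= #|U|
      & {in U, forall x, #|[set y in U | r x y]| <= 4 * m}].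
Proof.
move=> rs m0 C0 /andP[cL pL] szL; set q := 8 * C in pL szL *.
set L' := take q L.
have sL' : sparse_family r q m L'.
  apply/andP; split; first by apply/allP => S /mem_take /(allP cL).
  exact: subseq_pairwise (take_subseq _ _) pL.
have szL' : size L' = q by rewrite size_takel.
have [] := sparse_family_union rs sL'; set V := \bigcup_(S <- L') S.
rewrite szL' => cV eV.
pose B := [set x in V | 4 * m < #|[set y in V | r x y]|].
have cB : #|B| * (4 * m) <= edges r V V.
  rewrite -sum_nat_const; apply: (@leq_trans (edges r B V)); last first.
    by apply: edges_sub => //; apply/subsetP => x; rewrite inE => /andP[].
  by apply: leq_sum => x; rewrite inE => /andP[_ /ltnW].
have VL : V \subset \bigcup_(S <- L) S.
  by rewrite -[L](cat_take_drop q) big_cat subsetUl.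
exists (V :\: B); split.
- exact: subset_trans (subsetDl _ _) VL.
- have BV : B \subset V by apply/subsetP => x; rewrite inE => /andP[].
  have := cardsID B V; rewrite (setIidPr BV) cV.
  have q0 : 0 < q by rewrite /q; lia.
  have eV' : edges r V V <= 2 * q * (m * m).
    rewrite -(leq_pmul2l q0); apply: leq_trans eV _.
    by move: (m * m) => x; clear; lia.
  have : #|B| * 4 <= 2 * q * m.
    by have := leq_trans cB eV'; rewrite !mulnA leq_pmul2r.
  by rewrite /q; clear; lia.
move=> x; rewrite !inE => /andP[+ xV]; rewrite xV -leqNgt.
apply: leq_trans; apply/subset_leq_card/subsetP => y.
by rewrite !inE => /andP[/andP[_ ->] ->].
Qed.

(** Were both families shorter than [8 * C], the product of their lengths would be too small for
    [2 ^ (2 * (8 * C))]; the longer one gives [U]. *)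
Lemma rodl (H : sgraph) C : 0 < #|H| -> 0 < C -> exists2 M, 0 < M &
  forall (G : sgraph) m (X : {set G}),
    ~ contains_induced G H -> 0 < m -> M * m <= #|X| ->
    exists2 U : {set G}, U \subset X & C * (4 * m) <= #|U| /\
      ({in U, forall x, #|[set y in U | adj x y]| <= 4 * m} \/
       {in U, forall x, #|[set y in U | compl_adj x y]| <= 4 * m}).
Proof.
move=> h0 C0; have q0 : 0 < 8 * C by rewrite muln_gt0.
have [M M0 HM] := sparse_dense_families (2 * (8 * C)) h0 q0.
exists M => // G m X nH m0 szX.
have [L1 [L2 [sL1 sL2 L1X L2X szL]]] := HM G m X nH m0 szX.
have bigX (L : seq {set G}) : {in L, forall S : {set G}, S \subset X} ->
    \bigcup_(S <- L) S \subset X.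
  move=> LX; rewrite big_seq; elim/big_ind: _ => [|A B AX BX|S /LX //].
    exact: sub0set.
  by rewrite subUset AX.
have [le|lt] := leqP (8 * C) (size L1).
  have [U [UL cU dU]] := low_degree_subset (@adj_sym G) m0 C0 sL1 le.
  by exists U; [exact: subset_trans UL (bigX _ L1X) | split=> //; left].
have [le|lt'] := leqP (8 * C) (size L2).
  have [U [UL cU dU]] := low_degree_subset (@compl_adj_sym G) m0 C0 sL2 le.
  by exists U; [exact: subset_trans UL (bigX _ L2X) | split=> //; right].
move: szL; rewrite leqNgt expnM => /negP[].
apply: (@leq_trans (8 * C * (8 * C))).
  by apply: ltn_mul.
by rewrite expnAC -mulnn leq_mul // ltnW // ltn_expl.
Qed.

(** * Pure pairs and homogeneous sets *)

Lemma contains_induced_compl (G H : sgraph) :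
  contains_induced (compl G) H -> contains_induced G (compl H).
Proof.
move=> [f [finj fadj]]; exists f; split=> // x y.
rewrite /= /compl_adj -fadj /= /compl_adj (inj_eq finj).
by case: eqVneq => [->|_]; rewrite ?adj_irrefl //= negbK.
Qed.

(** [rodl] with ratio [4 * k + 15] meets the needs of [sparse_pair] for [e = 4 * m]; the dense case
    passes to the complement. *)
Lemma pure_pair k : 0 < k -> exists2 M, 0 < M &
  forall (G : sgraph) m (X : {set G}),
    ~ contains_induced G (hook k) -> ~ contains_induced G (compl (hook k)) ->
    0 < m -> M * m <= #|X| ->
    exists A B : {set G},
      [/\ A \subset X, B \subset X, m <= #|A|, m <= #|B|
        & {in A & B, forall x y, compl_adj x y} \/ {in A & B, forall x y, adj x y}].
Proof.
move=> k0; have h0 : 0 < #|hook k| by rewrite card_ord addnS.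
have [|M M0 HM] := @rodl (hook k) (4 * k + 15) h0; first by rewrite addnS.
exists M => // G m X nH nHc m0 szX.
have m4 : 0 < 4 * m by rewrite muln_gt0.
have le4 : m <= 4 * m by rewrite leq_pmull.
have [U UX [cU [dU|dU]]] := HM G m X nH m0 szX.
  have [A [B [AU BU aAB cA cB]]] := sparse_pair k0 nH m4 dU cU.
  exists A, B; split; rewrite ?(leq_trans le4) ?(subset_trans _ UX) //.
  by left; apply/anticompleteP.
have nH' : ~ contains_induced (compl G) (hook k) by move/contains_induced_compl.
have [A [B [AU BU aAB cA cB]]] := @sparse_pair (compl G) U _ k k0 nH' m4 dU cU.
exists A, B; split; rewrite ?(leq_trans le4) ?(subset_trans _ UX) //.
right=> x y xA yB; have := anticompleteP _ _ aAB x y xA yB.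
by rewrite /compl_adj /= /compl_adj; case: eqP => //= _ /negPn.
Qed.

(** In the two sides of a pure pair, the sets of one kind unite and the larger one of the other kind
    survives. The constant [M] of [pure_pair] is rounded up to [2 ^ M], for comparison with powers
    of two later. *)
Lemma clique_independent_product k : 0 < k -> exists N,
  forall (G : sgraph) t (X : {set G}),
    ~ contains_induced G (hook k) -> ~ contains_induced G (compl (hook k)) ->
    (2 ^ N) ^ t <= #|X| ->
    exists K S : {set G}, [/\ K \subset X, S \subset X, clique K, independent S
      & 2 ^ t <= #|K| * #|S|].
Proof.
move=> k0; have [M M0 HM] := pure_pair k0; exists M => G t X nH nHc.
elim: t X => [|t IH] X szX.
  have [x xX] : exists x, x \in X by apply/set0Pn; rewrite -card_gt0.
  exists [set x], [set x]; rewrite !sub1set xX cards1; split=> //.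
    by apply/forall_inP => y /set1P->; apply/forall_inP => z /set1P->; rewrite eqxx.
  by apply/forall_inP => y /set1P->; apply/forall_inP => z /set1P->; rewrite adj_irrefl.
have [||A [B [AX BX cA cB pAB]]] := HM G ((2 ^ M) ^ t) X nH nHc.
- by rewrite !expn_gt0.
- by apply: leq_trans szX; rewrite [X in _ <= X]expnS leq_mul2r ltnW ?orbT // ltn_expl.
have [K1 [S1 [K1A S1A cK1 iS1 le1]]] := IH A cA.
have [K2 [S2 [K2B S2B cK2 iS2 le2]]] := IH B cB.
have sub (C D : {set G}) : C \subset A -> D \subset B -> C :|: D \subset X.
  by move=> CA DB; rewrite subUset (subset_trans CA AX) (subset_trans DB BX).
have dbl a b c d : 2 ^ t <= a * c -> 2 ^ t <= b * d ->
    2 ^ t.+1 <= (a + b) * maxn c d.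
  move=> l1 l2; rewrite expnS mul2n -addnn mulnDl.
  by apply: leq_add; [apply: leq_trans l1 _|apply: leq_trans l2 _];
    rewrite leq_mul2l ?leq_maxl ?leq_maxr orbT.
have dAB : [disjoint A & B].
  apply/pred0P => x /=; apply/negP => /andP[xA xB].
  by case: pAB => /(_ x x xA xB); rewrite /compl_adj ?eqxx ?adj_irrefl.
have cardU (C D : {set G}) : C \subset A -> D \subset B -> #|C :|: D| = #|C| + #|D|.
  move=> CA DB; rewrite cardsU disjoint_setI0 ?cards0 ?subn0 //.
  exact: disjointWl CA (disjointWr DB dAB).
case: pAB => pAB.
  have iS : independent (S1 :|: S2).
    apply/forall_inP => x /setUP xS; apply/forall_inP => y /setUP yS.
    case: xS yS => xS [yS|yS].
    - by apply: (forall_inP (forall_inP iS1 x xS)).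
    - by have /andP[] := pAB x y (subsetP S1A x xS) (subsetP S2B y yS).
    - rewrite adj_sym.
      by have /andP[] := pAB y x (subsetP S1A y yS) (subsetP S2B x xS).
    - by apply: (forall_inP (forall_inP iS2 x xS)).
  have [K [KX cK szK]] : exists K : {set G},
      [/\ K \subset X, clique K & #|K| = maxn #|K1| #|K2|].
    case: leqP => _; first by exists K2; rewrite (subset_trans K2B BX).
    by exists K1; rewrite (subset_trans K1A AX).
  exists K, (S1 :|: S2); split=> //; first exact: sub.
  by rewrite szK cardU // mulnC dbl // mulnC.
have cK : clique (K1 :|: K2).
  apply/forall_inP => x /setUP xK; apply/forall_inP => y /setUP yK.
  case: xK yK => xK [yK|yK].
  - by apply: (forall_inP (forall_inP cK1 x xK)).
  - by rewrite pAB ?implybT ?(subsetP K1A) ?(subsetP K2B).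
  - by rewrite adj_sym pAB ?implybT ?(subsetP K1A) ?(subsetP K2B).
  - by apply: (forall_inP (forall_inP cK2 x xK)).
have [S [SX iS szS]] : exists S : {set G},
    [/\ S \subset X, independent S & #|S| = maxn #|S1| #|S2|].
  case: leqP => _; first by exists S2; rewrite (subset_trans S2B BX).
  by exists S1; rewrite (subset_trans S1A AX).
exists (K1 :|: K2), S; split=> //; first exact: sub.
by rewrite szS cardU // dbl.
Qed.

(** * Polynomial lower bound for the homogeneous number *)

Lemma hom_num_ge (G : sgraph) (A : {set G}) : homogeneous A -> #|A| <= hom_num G.
Proof. by move=> hA; apply: (leq_bigmax_cond (F := fun A : {set G} => #|A|)). Qed.

Lemma hom_num_ge2 (G : sgraph) : 2 <= #|G| -> 2 <= hom_num G.
Proof.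
move=> /card_gt1P[x [y [_ _ xy]]].
have <- : #|[set x; y]| = 2 by rewrite cards2 xy.
have ayx := adj_sym x y.
apply: hom_num_ge; apply/orP; case axy: (adj x y) ayx => /esym ayx; [left|right];
  apply/forall_inP => u; rewrite !inE => /orP[]/eqP->;
  apply/forall_inP => v; rewrite !inE => /orP[]/eqP->;
  by rewrite ?eqxx ?adj_irrefl // ?axy ?ayx ?implybT.
Qed.

Lemma hom_num_poly k : 0 < k -> exists2 N, 0 < N & forall G : sgraph,
    2 <= #|G| ->
    ~ contains_induced G (hook k) -> ~ contains_induced G (compl (hook k)) ->
    #|G| < hom_num G ^ N.
Proof.
move=> k0; have [N HN] := clique_independent_product k0.
(* [N] may be 0, and [N.+1] makes the base of the logarithm exceed 1. In the exponent 4, the product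
   of clique and independent set accounts for 2, and the rounding of the logarithm, through
   [2 <= h], for the other 2. *)
exists (4 * N.+1) => // G G2 nH nHc.
have M1 : 1 < 2 ^ N.+1 by rewrite expnS; have := expn_gt0 2 N; lia.
have /andP[lo hi] := trunc_log_bounds M1 (ltnW G2).
set t := trunc_log _ _ in lo hi.
have [|K [S [_ _ cK iS szKS]]] := HN G t setT nH nHc.
  rewrite cardsT; apply: leq_trans lo.
  by rewrite -!expnM leq_pexp2l // leq_mul2r leqnSn orbT.
set h := hom_num G.
have h2 : 2 <= h := hom_num_ge2 G2.
have hh : 2 ^ t <= h ^ 2.
  apply: leq_trans szKS _; rewrite -mulnn.
  by apply: leq_mul; apply: hom_num_ge; rewrite /homogeneous ?cK ?iS ?orbT.
have hh4 : 2 ^ t.+1 <= h ^ 4.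
  rewrite (expnD h 2 2) expnS; apply: leq_mul => //.
  by rewrite (leq_trans h2) // -[X in X <= _]expn1 leq_pexp2l // ltnW.
apply: leq_trans hi _; rewrite -expnM mulnC expnM [X in _ <= X]expnM.
by rewrite leq_exp2r.
Qed.

Local Open Scope ring_scope.

Theorem theorem1p3 (R : realType) (k : nat) (hk : (1 <= k)%N) :
  exists c : R, 0 < c /\
    forall n : nat, (2 <= n)%N ->
    forall G : sgraph, #|G| = n ->
      ~ contains_induced G (hook k) ->
      ~ contains_induced G (compl (hook k)) ->
      n%:R `^ c < (hom_num G)%:R.
Proof.
have [N N0 HN] := hom_num_poly hk.
have N0R : 0 < N%:R :> R by rewrite ltr0n.
(* The strict bound [n < hom_num G ^ N] is raised to the power [1 / N]. *)
exists N%:R^-1; split; first by rewrite invr_gt0.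
move=> n n2 G cG nH nHc.
have := HN G; rewrite cG => /(_ n2 nH nHc).
rewrite -(ltr_nat R) natrX -powR_mulrn ?ler0n // => lt.
have := gt0_ltr_powR (r := N%:R^-1) _ _ _ lt.
rewrite -powRrM mulfV ?gt_eqF // powRr1 ?ler0n //.
by apply; rewrite ?invr_gt0 // nnegrE ?powR_ge0 ?ler0n.
Qed.
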